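(* Let $n$ be a positive integer, let $b\in\mathbb{C}$, and let $A$ be an irreducible module over the associative algebra $\mathcal{K}_n$. Then the $\mathcal{W}_n$-module $A_b$ is irreducible if and only if one of the following holds: (i) $b\notin\{0,1\}$; (ii) $b=1$ and $\mathfrak{h}(A)=A$; (iii) $b=0$ and $A$ is not isomorphic, as a $\mathcal{K}_n$-module, to the natural $\mathcal{K}_n$-module $\mathcal{A}_n$.
   Context: All vector spaces and algebras are over $\mathbb{C}$. $\mathcal{A}_n=\mathbb{C}[t_1^{\pm1},\dots,t_n^{\pm1}]$ is the Laurent polynomial algebra and $\partial_i=t_i\frac{\partial}{\partial t_i}$. For $r=(r_1,\dots,r_n)\in\mathbb{Z}^n$ and $u=(u_1,\dots,u_n)\in\mathbb{C}^n$ put $t^r=t_1^{r_1}\cdots t_n^{r_n}$, $D(u,r)=t^r\sum_{i=1}^n u_i\partial_i$, and $(u|v)=\sum_i u_iv_i$ for $u,v\in\mathbb{C}^n$. The Witt algebra $\mathcal{W}_n$ is the Lie algebra of all derivations of $\mathcal{A}_n$; it is spanned by the $D(u,r)$ ($u\in\mathbb{C}^n$, $r\in\mathbb{Z}^n$), with $[D(u,r),D(v,s)]=D(w,r+s)$, $w=(u|s)v-(v|r)u$. $\mathcal{K}_n=\mathbb{C}[t_1^{\pm1},\dots,t_n^{\pm1},\partial_1,\dots,\partial_n]$ is the associative algebra of differential operators on $\mathcal{A}_n$ generated by multiplication by $t_i^{\pm1}$ and by the $\partial_i$; the natural $\mathcal{K}_n$-module is $\mathcal{A}_n$ with the action by differential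 operators. $\mathfrak{h}=\bigoplus_{i=1}^n\mathbb{C}\partial_i$, and for a $\mathcal{K}_n$-module $A$, $\mathfrak{h}(A)=\sum_{i=1}^n\partial_i A$. For a $\mathcal{K}_n$-module $A$ and $b\in\mathbb{C}$, $A_b$ denotes the $\mathcal{W}_n$-module with underlying space $A$ and action $D(u,k)\circ v=D(u,k)v+b(u|k)t^kv$ for $u\in\mathbb{C}^n$, $k\in\mathbb{Z}^n$, $v\in A$ (on the right-hand side, elements of $\mathcal{K}_n$ act on $A$). *)

(* Defs.v *)
From HB Require Import structures.
From mathcomp Require Import all_boot all_order all_algebra.
From mathcomp Require Import boolp classical_sets functions reals complex.
From mathcomp Require Import finmap ring.
From mathcomp.multinomials Require Import monalg.

Set Implicit Arguments.
Unset Strict Implicit.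
Unset Printing Implicit Defensive.

Import GRing.Theory.
Local Open Scope fset_scope.
Local Open Scope ring_scope.

(* Laurent polynomials: the group algebra of Z^n, i.e. finitely supported
   functions Z^n -> K with the convolution product; << c *g r >> is c t^r. *)
Definition laurent (K : fieldType) (n : nat) : Type :=
  {malg K[{ffun 'I_n -> int}]}.

HB.lock Definition lmonom (K : fieldType) (n : nat) (r : {ffun 'I_n -> int}) :
  laurent K n := << r >>.
Canonical lmonom_unlockable := Unlockable lmonom.unlock.

HB.lock Definition lmul (K : fieldType) (n : nat) (f g : laurent K n) :
    laurent K n :=
  \sum_(r <- msupp f) \sum_(s <- msupp g) << f@_r * g@_s *g r + s >>.
Canonical lmul_unlockable := Unlockable lmul.unlock.

Section LaurentAlgebra.
Variables (K : fieldType) (n : nat).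

HB.instance Definition _ := GRing.Lmodule.copy (laurent K n)
  {malg K[{ffun 'I_n -> int}]}.

Implicit Types (f g h : laurent K n) (r s : {ffun 'I_n -> int}) (c : K).

Local Notation lmonom := (@lmonom K n).
Local Notation lmul := (@lmul K n).

Lemma mcoeff_lmonom r s : (lmonom r)@_s = (r == s)%:R.
Proof. by rewrite unlock mcoeffU. Qed.

Let lmulw (d1 d2 : {fset {ffun 'I_n -> int}}) f g :
  msupp f `<=` d1 -> msupp g `<=` d2 ->
  lmul f g = \sum_(r <- d1) \sum_(s <- d2) << f@_r * g@_s *g r + s >>.
Proof.
move=> le_d1 le_d2; rewrite unlock (big_fset_incl _ le_d1) /=.
  apply/eq_bigr=> k1 _; apply/big_fset_incl => // k _ /mcoeff_outdom ->.
  by rewrite mulr0 monalgU0.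
move=> k _ /mcoeff_outdom g1k.
by rewrite big1 => // k' _; rewrite g1k mul0r monalgU0.
Qed.

Let lmulUU (c1 c2 : K) r s :
  lmul << c1 *g r >> << c2 *g s >> = << c1 * c2 *g r + s >>.
Proof. by rewrite (lmulw msuppU_le msuppU_le) !big_seq_fset1 !mcoeffUU. Qed.

Let lmulC : commutative lmul.
Proof.
move=> f g; rewrite unlock exchange_big; apply: eq_bigr => r _.
by apply: eq_bigr => s _; rewrite mulrC addrC.
Qed.

Let lmulDl : left_distributive lmul +%R.
Proof.
move=> g1 g2 g; rewrite (lmulw (msuppD_le _ _) (fsubset_refl _)).
rewrite [in RHS](lmulw (fsubsetUl _ (msupp g2)) (fsubset_refl _)).
rewrite [in RHS](lmulw (fsubsetUr (msupp g1) _) (fsubset_refl _)).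
rewrite -big_split /=; apply/eq_bigr=> k1 _.
rewrite -big_split /=; apply/eq_bigr=> k2 _.
by rewrite mcoeffD mulrDl monalgUD.
Qed.

Let lmulDr : right_distributive lmul +%R.
Proof. by move=> f g h; rewrite lmulC lmulDl !(lmulC _ f). Qed.

Let lmul0 f : lmul f 0 = 0.
Proof. by apply: (@addIr _ (lmul f 0)); rewrite -lmulDr !add0r. Qed.

Let lmul_suml (I : Type) (t : seq I) (F : I -> laurent K n) g :
  lmul (\sum_(i <- t) F i) g = \sum_(i <- t) lmul (F i) g.
Proof.
apply: (big_morph (lmul^~ g)) => [x y|]; first by rewrite lmulDl.
by rewrite lmulC lmul0.
Qed.

Let lmul_sumr (I : Type) (t : seq I) (F : I -> laurent K n) g :
  lmul g (\sum_(i <- t) F i) = \sum_(i <- t) lmul g (F i).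
Proof. by rewrite lmulC lmul_suml; apply: eq_bigr => i _; rewrite lmulC. Qed.

Lemma laurent_ind (P : laurent K n -> Prop) :
  P 0 -> (forall c r f, P f -> P (c *: lmonom r + f)) -> forall f, P f.
Proof.
move=> P0 PD f; rewrite [f]monalgE; elim: (enum_fset _) => [|r s IH].
  by rewrite big_nil.
rewrite big_cons (_ : << _ *g r >> = f@_r *: lmonom r); first exact: PD.
by apply/malgP => k; rewrite mcoeffZ mcoeff_lmonom mcoeffU mulr_natr.
Qed.

Let lmulZl c f g : lmul (c *: f) g = c *: lmul f g.
Proof.
rewrite (lmulw (msuppZ_le _ _) (fsubset_refl _)).
rewrite (lmulw (fsubset_refl (msupp f)) (fsubset_refl (msupp g))) scaler_sumr.
apply: eq_bigr => r _; rewrite scaler_sumr; apply: eq_bigr => s _.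
by apply/malgP => k; rewrite !(mcoeffZ, mcoeffU) mulrnAr mulrA.
Qed.

Let lmulZr c f g : lmul f (c *: g) = c *: lmul f g.
Proof. by rewrite lmulC lmulZl lmulC. Qed.

Lemma laurent_linear_ext (V : lmodType K) (F G : laurent K n -> V) :
  linear F -> linear G -> (forall r, F (lmonom r) = G (lmonom r)) -> F =1 G.
Proof.
move=> linF linG eqFG; elim/laurent_ind => [|c r f IH].
  have lin0 (H : laurent K n -> V) : linear H -> H 0 = 0.
    move=> linH; have := linH (-1) 0 0.
    by rewrite scaler0 addr0 scaleN1r addNr.
  by rewrite !lin0.
by rewrite linF linG IH eqFG.
Qed.

Let lmul_linr f : linear (lmul f).
Proof. by move=> c g h; rewrite (lmulDr f (c *: g) h) (lmulZr c f g). Qed.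

Let lmul_linl g : linear (lmul^~ g).
Proof. by move=> c f h /=; rewrite (lmulDl (c *: f) h g) (lmulZl c f g). Qed.

Let lmulA : associative lmul.
Proof.
move=> f g h; move: h; apply: laurent_linear_ext => [||t].
- by move=> c x y; rewrite (lmul_linr g) (lmul_linr f).
- exact: lmul_linr.
move: g; apply: laurent_linear_ext => [||s].
- by move=> c x y; rewrite (lmul_linl (lmonom t)) (lmul_linr f).
- by move=> c x y; rewrite (lmul_linr f) (lmul_linl (lmonom t)).
move: f; apply: laurent_linear_ext => [||r].
- exact: lmul_linl.
- by move=> c x y; rewrite (lmul_linl (lmonom s)) (lmul_linl (lmonom t)).
by rewrite !lmonom.unlock !lmulUU !mulr1 addrA.
Qed.

Let lmul1 : left_id (lmonom 0) lmul.
Proof.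
apply: laurent_linear_ext => [||r]; [exact: lmul_linr|by []|].
by rewrite !lmonom.unlock lmulUU mulr1 add0r.
Qed.

Let lone_neq0 : lmonom 0 != 0.
Proof. by rewrite unlock monalgU_eq0 oner_eq0. Qed.

HB.instance Definition _ := GRing.Zmodule_isComNzRing.Build (laurent K n)
  lmulA lmulC lmul1 lmulDl lone_neq0.
HB.instance Definition _ := GRing.Lmodule_isLalgebra.Build K (laurent K n)
  (fun c f g => esym (lmulZl c f g)).
HB.instance Definition _ := GRing.Lalgebra_isComAlgebra.Build K (laurent K n).

Lemma lmonom0 : lmonom 0 = 1. Proof. by []. Qed.

Lemma lmonomD r s : lmonom (r + s) = lmonom r * lmonom s.
Proof. by rewrite !lmonom.unlock [RHS]lmulUU mulr1. Qed.

End LaurentAlgebra.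

(* The associative algebra End_K(B) of K-linear endomorphisms of B, under
   composition.  The predicate is made boolean classically so that lend is a
   subtype of B -> B. *)
Section LinearEndomorphisms.
Variables (K : fieldType) (B : comAlgType K).

Definition linear_pred : {pred B -> B} := fun f => `[< linear f >].

Fact linear_pred_submod_closed : submod_closed linear_pred.
Proof.
split=> [|a f g /asboolP linf /asboolP ling]; apply/asboolP => c x y /=.
  by rewrite scaler0 addr0.
rewrite !fctE linf ling !scalerDr !scalerA !addrA [a * c]mulrC.
by congr (_ + _); rewrite -!addrA; congr (_ + _); rewrite addrC.
Qed.
HB.instance Definition _ := GRing.isSubmodClosed.Build K (B -> B) linear_pred
  linear_pred_submod_closed.

Record lend : Type := Lend
  { lend_fun :> B -> B; lend_subproof : lend_fun \in linear_pred }.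

HB.instance Definition _ := [isSub for lend_fun].
HB.instance Definition _ := [Choice of lend by <:].
HB.instance Definition _ := [SubChoice_isSubLmodule of lend by <:].

Implicit Types (f g : lend) (x y : B).

Lemma lendP f g : (f : B -> B) =1 g -> f = g.
Proof. by move=> eq_fg; apply/val_inj/funext. Qed.

Lemma lend_linear f : linear (f : B -> B).
Proof. exact/asboolP/lend_subproof. Qed.

HB.instance Definition _ f := GRing.isLinear.Build K B B _ f (lend_linear f).

Definition lend_of (f : B -> B) (linf : linear f) : lend :=
  Lend (asboolT linf).

Fact lend_one_linear : linear (@id B). Proof. by []. Qed.
Fact lend_comp_linear f g : linear (f \o g).
Proof. by move=> c x y /=; rewrite !linearP. Qed.

Definition lend_one := lend_of lend_one_linear.
Definition lend_comp f g := lend_of (lend_comp_linear f g).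

Lemma lendD f g x : (f + g) x = f x + g x. Proof. by []. Qed.
Lemma lend0 x : (0 : lend) x = 0. Proof. by []. Qed.
Lemma lendN f x : (- f) x = - f x. Proof. by []. Qed.
Lemma lendZ c f x : (c *: f) x = c *: f x. Proof. by []. Qed.

Let compA : associative lend_comp. Proof. by move=> f g h; apply: lendP. Qed.
Let comp1 : left_id lend_one lend_comp. Proof. by move=> f; apply: lendP. Qed.
Let compr1 : right_id lend_one lend_comp. Proof. by move=> f; apply: lendP. Qed.
Let compDl : left_distributive lend_comp +%R.
Proof. by move=> f g h; apply: lendP. Qed.
Let compDr : right_distributive lend_comp +%R.
Proof. by move=> f g h; apply: lendP => x; rewrite lendD /= linearD. Qed.
Let one_neq0 : lend_one != 0.
Proof.
apply/eqP => /(congr1 (fun f : lend => f 1)) /eqP.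
by rewrite lend0 /= oner_eq0.
Qed.

HB.instance Definition _ := GRing.Zmodule_isNzRing.Build lend
  compA comp1 compr1 compDl compDr one_neq0.

Lemma lendM f g x : (f * g) x = f (g x). Proof. by []. Qed.
Lemma lend1 x : (1 : lend) x = x. Proof. by []. Qed.

Let scaleAl c f g : c *: (f * g) = c *: f * g.
Proof. by apply: lendP. Qed.
Let scaleAr c f g : c *: (f * g) = f * (c *: g).
Proof. by apply: lendP => x; rewrite lendM lendZ linearZ. Qed.
HB.instance Definition _ := GRing.Lmodule_isLalgebra.Build K lend scaleAl.
HB.instance Definition _ := GRing.Lalgebra_isAlgebra.Build K lend scaleAr.

Lemma lend_sum (I : Type) (s : seq I) (F : I -> lend) x :
  (\sum_(i <- s) F i) x = \sum_(i <- s) F i x.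
Proof. by elim/big_rec2: _ => // i y f _ <-. Qed.

Fact mulend_linear x : linear (fun y => x * y).
Proof. by move=> c y z; rewrite mulrDr scalerAr. Qed.
Definition mulend x : lend := lend_of (mulend_linear x).

Lemma mulendE x y : mulend x y = x * y. Proof. by []. Qed.

End LinearEndomorphisms.

HB.mixin Record Lmodule_isLie (K : fieldType) L of GRing.Lmodule K L := {
  lie : L -> L -> L;
  lie_linearl : forall y : L, linear (lie^~ y);
  lie_linearr : forall x : L, linear (lie x);
  liexx : forall x : L, lie x x = 0;
  lie_jacobi : forall x y z : L,
    lie x (lie y z) + lie y (lie z x) + lie z (lie x y) = 0 }.

#[short(type="lieAlgType")]
HB.structure Definition LieAlgebra (K : fieldType) :=
  { L of Lmodule_isLie K L & GRing.Lmodule K L }.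

HB.mixin Record Lmodule_isLieModule (K : fieldType) (L : lieAlgType K) M
    of GRing.Lmodule K M := {
  lie_act : L -> M -> M;
  lie_act_linearl : forall v : M, linear (lie_act^~ v);
  lie_act_linearr : forall x : L, linear (lie_act x);
  lie_act_lie : forall (x y : L) (v : M),
    lie_act (lie x y) v = lie_act x (lie_act y v) - lie_act y (lie_act x v) }.

#[short(type="lieModType")]
HB.structure Definition LieModule (K : fieldType) (L : lieAlgType K) :=
  { M of Lmodule_isLieModule K L M & GRing.Lmodule K M }.

(* Irreducible modules are nonzero.  Submodules are arbitrary (not only
   decidable) subsets. *)
Definition irreducible_module (S : nzRingType) (M : lmodType S) : Prop :=
  (exists v : M, v != 0) /\
  forall U : set M, submod_closed (mem U) -> U = [set 0]%classic \/ U = setT.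

Definition irreducible_lie_module (K : fieldType) (L : lieAlgType K)
    (M : lieModType L) : Prop :=
  (exists v : M, v != 0) /\
  forall U : set M, submod_closed (mem U) ->
    (forall (x : L) (v : M), U v -> U (lie_act x v)) ->
    U = [set 0]%classic \/ U = setT.

Definition isomorphic_modules (S : nzRingType) (M N : lmodType S) : Prop :=
  exists f : {linear M -> N}, bijective f.

Section Derivations.
Variables (K : fieldType) (B : comAlgType K).

Definition derivation_pred : {pred lend B} :=
  fun d => `[< forall x y : B, d (x * y) = d x * y + x * d y >].

Fact derivation_pred_submod_closed : submod_closed derivation_pred.
Proof.
split=> [|c d e /asboolP derd /asboolP dere]; apply/asboolP => x y.
  by rewrite !lend0 mul0r mulr0 addr0.
rewrite !lendD !lendZ derd dere scalerDr mulrDl mulrDr scalerAl scalerAr.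
by rewrite addrACA.
Qed.
HB.instance Definition _ := GRing.isSubmodClosed.Build K (lend B)
  derivation_pred derivation_pred_submod_closed.

Record derivation : Type := Derivation
  { der_end :> lend B; der_subproof : der_end \in derivation_pred }.

HB.instance Definition _ := [isSub for der_end].
HB.instance Definition _ := [Choice of derivation by <:].
HB.instance Definition _ := [SubChoice_isSubLmodule of derivation by <:].

Implicit Types (d e : derivation) (x y : B).

Lemma derM d x y : d (x * y) = d x * y + x * d y.
Proof. by have /asboolP := der_subproof d; apply. Qed.

Definition derivation_of (d : lend B)
    (derd : forall x y : B, d (x * y) = d x * y + x * d y) : derivation :=
  Derivation (asboolT derd).

Definition lend_commutator (f g : lend B) : lend B := f * g - g * f.

Fact der_lie_subproof d e x y :
  lend_commutator d e (x * y) =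
  lend_commutator d e x * y + x * lend_commutator d e y.
Proof.
rewrite !(lendD, lendN, lendM) !derM !linearD /= !derM.
by ring.
Qed.

Definition der_lie d e : derivation := derivation_of (der_lie_subproof d e).

Lemma der_lieE d e : 
  der_lie d e = (d : lend B) * e - (e : lend B) * d :> lend B. Proof. by []. Qed.

Lemma derP d e : (d : lend B) = e -> d = e. Proof. exact: val_inj. Qed.

Lemma derDE d e : (d + e : derivation) = (d : lend B) + e :> lend B.
Proof. by []. Qed.
Lemma derZE c d : (c *: d : derivation) = c *: (d : lend B) :> lend B.
Proof. by []. Qed.

Let lie_lin1 e : linear (der_lie^~ e).
Proof.
move=> c d1 d2; apply: derP; rewrite derDE derZE !der_lieE derDE derZE.
by rewrite mulrDl mulrDr -scalerAl -scalerAr scalerBr opprD addrACA.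
Qed.
Let lie_lin2 d : linear (der_lie d).
Proof.
move=> c d1 d2; apply: derP; rewrite derDE derZE !der_lieE derDE derZE.
by rewrite mulrDl mulrDr -scalerAl -scalerAr scalerBr opprD addrACA.
Qed.
Let lie_xx d : der_lie d d = 0.
Proof. by apply: derP; rewrite der_lieE subrr. Qed.
Let lie_jac d e f :
  der_lie d (der_lie e f) + der_lie e (der_lie f d) + der_lie f (der_lie d e)
  = 0.
Proof.
apply: derP; rewrite !derDE !der_lieE !mulrBr !mulrBl !mulrA.
by apply: lendP => x; rewrite !(lendD, lendN) lend0; ring.
Qed.

HB.instance Definition _ := Lmodule_isLie.Build K derivation
  lie_lin1 lie_lin2 lie_xx lie_jac.

End Derivations.

(* partial_i = t_i d/dt_i, i.e. partial_i t^r = r_i t^r. *)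
HB.lock Definition lpartial_fun (K : fieldType) (n : nat) (i : 'I_n)
    (f : laurent K n) : laurent K n :=
  [malg r in msupp f => (r i)%:~R * f@_r].
Canonical lpartial_fun_unlockable := Unlockable lpartial_fun.unlock.

Section LaurentOperators.
Variables (K : fieldType) (n : nat).

Local Notation A := (laurent K n).
Local Notation Zn := {ffun 'I_n -> int}.
Local Notation Kn := {ffun 'I_n -> K}.

Implicit Types (f g : A) (r s : Zn) (u v : Kn) (i j : 'I_n) (c : K).

Definition zbasis i : Zn := [ffun j => (j == i)%:R].
Definition lvar i : A := lmonom K (zbasis i).
Definition lvarV i : A := lmonom K (- zbasis i).

Local Notation lpartial_fun := (@lpartial_fun K n).

Lemma lpartialE i f r : (lpartial_fun i f)@_r = (r i)%:~R * f@_r.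
Proof. by rewrite unlock mcoeffE; case: msuppP; rewrite ?mulr0. Qed.

Fact lpartial_linear i : linear (lpartial_fun i).
Proof.
move=> c f g; apply/malgP => r.
by rewrite mcoeffD mcoeffZ !lpartialE mcoeffD mcoeffZ mulrDr mulrCA.
Qed.

Definition lpartial i : lend A := lend_of (lpartial_linear i).
Lemma lpartialZ i c f : lpartial i (c *: f) = c *: lpartial i f.
Proof. exact: linearZ. Qed.

Lemma lpartial_sum i (I : Type) (s : seq I) (F : I -> A) :
  lpartial i (\sum_(j <- s) F j) = \sum_(j <- s) lpartial i (F j).
Proof. exact: linear_sum. Qed.

Lemma lpartialB i f g : lpartial i (f - g) = lpartial i f - lpartial i g.
Proof. exact: linearB. Qed.

Lemma lpartial_monom i r : lpartial i (lmonom K r) = (r i)%:~R *: lmonom K r.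
Proof.
apply/malgP => s; rewrite lpartialE mcoeffZ !mcoeff_lmonom.
by case: eqP => [->|]; rewrite ?mulr0.
Qed.

Lemma lpartialM i f g :
  lpartial i (f * g) = lpartial i f * g + f * lpartial i g.
Proof.
move: g; apply: laurent_linear_ext => [||s].
- by move=> c x y; rewrite mulrDr -scalerAr linearP.
- move=> c x y; rewrite linearP !mulrDr -!scalerAr scalerDr addrACA.
  by rewrite scalerAr.
move: f; apply: laurent_linear_ext => [||r].
- by move=> c x y; rewrite mulrDl -scalerAl linearP.
- move=> c x y; rewrite linearP !mulrDl -!scalerAl scalerDr.
  by rewrite -!addrA; congr (_ + _); rewrite addrCA.
rewrite -lmonomD !lpartial_monom -scalerAl -scalerAr -lmonomD.
by rewrite -scalerDl ffunE rmorphD.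
Qed.

(* D(u, r) = t^r \sum_i u_i partial_i as an endomorphism of the Laurent
   algebra. *)
Definition lend_D u r : lend A :=
  mulend (lmonom K r) * \sum_i u i *: lpartial i.

Lemma lend_DE u r f :
  lend_D u r f = lmonom K r * \sum_i u i *: lpartial i f.
Proof. by rewrite lendM mulendE lend_sum. Qed.

Definition witt : Type := derivation A.

HB.instance Definition _ := LieAlgebra.copy witt (derivation A).

Fact witt_D_subproof u r f g :
  lend_D u r (f * g) = lend_D u r f * g + f * lend_D u r g.
Proof.
rewrite !lend_DE [X in _ = _ + X]mulrCA -mulrA -mulrDr; congr (_ * _).
rewrite mulr_suml mulr_sumr -big_split; apply: eq_bigr => i _; rewrite [RHS]/=.
by rewrite lpartialM scalerDr scalerAl scalerAr.
Qed.

Definition witt_D u r : witt := derivation_of (witt_D_subproof u r).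

Lemma witt_DE u r : witt_D u r = lend_D u r :> lend A. Proof. by []. Qed.

(* The algebra K_n: the smallest subalgebra of the endomorphisms of the
   Laurent algebra containing the multiplications by t_i and t_i^-1 and the
   partial_i. *)
Definition diffop_pred : {pred lend A} := fun x =>
  `[< forall S : {pred lend A}, subalg_closed S ->
      (forall i, mulend (lvar i) \in S) ->
      (forall i, mulend (lvarV i) \in S) ->
      (forall i, lpartial i \in S) -> x \in S >].

Fact diffop_pred_subalg_closed : subalg_closed diffop_pred.
Proof.
split=> [|c x y /asboolP Sx /asboolP Sy|x y /asboolP Sx /asboolP Sy];
  apply/asboolP => S Ssub St StV Sd; case: (Ssub) => S1 SL SM //.
- by apply: SL; [apply: Sx | apply: Sy].
- by apply: SM; [apply: Sx | apply: Sy].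
Qed.
HB.instance Definition _ := GRing.isSubalgClosed.Build K (lend A) diffop_pred
  diffop_pred_subalg_closed.

Record diffop : Type := Diffop
  { diffop_end :> lend A; diffop_subproof : diffop_end \in diffop_pred }.

HB.instance Definition _ := [isSub for diffop_end].
HB.instance Definition _ := [Choice of diffop by <:].
HB.instance Definition _ := [SubChoice_isSubAlgebra of diffop by <:].

Implicit Types (x y : diffop) (d e : witt).

Lemma diffopP x y : (x : lend A) = y -> x = y. Proof. exact: val_inj. Qed.

Lemma diffopDE x y : x + y = (x : lend A) + y :> lend A. Proof. by []. Qed.
Lemma diffopNE x : - x = - (x : lend A) :> lend A. Proof. by []. Qed.
Lemma diffopZE c x : c *: x = c *: (x : lend A) :> lend A. Proof. by []. Qed.
Lemma diffopME x y : x * y = (x : lend A) * y :> lend A. Proof. by []. Qed.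

Lemma lpartial_diffop i : lpartial i \in diffop_pred.
Proof. by apply/asboolP => S _ _ _; apply. Qed.

Definition dpartial i : diffop := Diffop (lpartial_diffop i).

Lemma zbasis_sum r : r = \sum_i zbasis i *~ r i.
Proof.
apply/ffunP => j; rewrite sum_ffunE (bigD1 j) //= big1 ?addr0 => [|i neq_ij].
  by rewrite ffunMzE ffunE eqxx intz.
by rewrite ffunMzE ffunE eq_sym (negPf neq_ij) mul0rz.
Qed.

Lemma lmonom_diffop r : mulend (lmonom K r) \in diffop_pred.
Proof.
have S0 : mulend (lmonom K 0) \in diffop_pred.
  suff -> : mulend (lmonom K 0) = 1 :> lend A by exact: rpred1.
  by apply: lendP => f; rewrite mulendE lmonom0 mul1r.
have SD s t : mulend (lmonom K s) \in diffop_pred ->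
    mulend (lmonom K t) \in diffop_pred ->
    mulend (lmonom K (s + t)) \in diffop_pred.
  move=> Ss St; suff -> : mulend (lmonom K (s + t)) =
    mulend (lmonom K s) * mulend (lmonom K t) by apply: rpredM.
  by apply: lendP => f; rewrite lendM !mulendE lmonomD mulrA.
have SMn s m : mulend (lmonom K s) \in diffop_pred ->
    mulend (lmonom K (s *+ m)) \in diffop_pred.
  by move=> Ss; elim: m => [|m IH]; rewrite ?mulr0n // mulrS; apply: SD.
rewrite [r]zbasis_sum; elim/big_ind: _ => // i _; case: (r i) => m.
  by apply: SMn; apply/asboolP => S _ St _ _; apply: St.
rewrite NegzE mulrNz -mulNrz; apply: SMn.
by apply/asboolP => S _ _ StV _; apply: StV.
Qed.

Lemma mulend_diffop f : mulend f \in diffop_pred.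
Proof.
elim/laurent_ind: f => [|c r f Sf].
  suff -> : mulend 0 = 0 :> lend A by exact: rpred0.
  by apply: lendP => f; rewrite mulendE mul0r.
suff -> : mulend (c *: lmonom K r + f) = c *: mulend (lmonom K r) + mulend f.
  by apply: rpredD => //; apply: rpredZ; apply: lmonom_diffop.
by apply: lendP => g; rewrite lendD lendZ !mulendE mulrDl scalerAl.
Qed.

Definition dmul f : diffop := Diffop (mulend_diffop f).

Definition diffop_D u r : diffop :=
  dmul (lmonom K r) * \sum_i u i *: dpartial i.

Lemma diffop_sum (I : Type) (s : seq I) (F : I -> diffop) :
  \sum_(i <- s) F i = \sum_(i <- s) (F i : lend A) :> lend A.
Proof. by elim/big_rec2: _ => // i y1 y2 _ <-. Qed.

Lemma diffop_DE u r : diffop_D u r = lend_D u r :> lend A.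
Proof. by rewrite diffopME diffop_sum. Qed.

(* Every derivation of the Laurent algebra has the form
   d = \sum_i (t_i^-1 d(t_i)) partial_i. *)
Definition witt_coef d i : A := lvarV i * d (lvar i).

Definition witt_diffop d : diffop := \sum_i dmul (witt_coef d i) * dpartial i.

Lemma witt_diffopE d : witt_diffop d = (d : lend A) :> lend A.
Proof.
rewrite diffop_sum; apply: lendP; apply: laurent_linear_ext => [||r].
- exact: lend_linear.
- exact: lend_linear.
pose L s := lmonom K (- s) * d (lmonom K s).
have mV s : lmonom K (- s) * lmonom K s = 1 by rewrite -lmonomD addNr.
have LD : {morph L : s t / s + t}.
  move=> s t; rewrite /L opprD !lmonomD derM.
  transitivity ((lmonom K (- t) * lmonom K t) * (lmonom K (- s) * d (lmonom K s))
    + (lmonom K (- s) * lmonom K s) * (lmonom K (- t) * d (lmonom K t))).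
    by ring.
  by rewrite !mV !mul1r.
have LB : zmod_morphism L.
  move=> s t; apply: (@addIr _ (L t)); rewrite -LD.
  by rewrite addrNK subrK.
pose LB' := GRing.isZmodMorphism.Build _ _ L LB.
pose La : {additive Zn -> A} := HB.pack L LB'.
have Lr : L r = \sum_i (r i)%:~R *: witt_coef d i.
  rewrite -[L]/(La : Zn -> A) {1}[r]zbasis_sum raddf_sum; apply: eq_bigr => i _.
  by rewrite raddfMz scaler_int.
have -> : d (lmonom K r) = lmonom K r * L r.
  by rewrite /L mulrCA mulrA mV mul1r.
rewrite lend_sum Lr mulr_sumr; apply: eq_bigr => i _.
by rewrite lendM mulendE lpartial_monom -!scalerAr mulrC.
Qed.

(* For d = \sum_i f_i partial_i, the divergence \sum_i partial_i(f_i); it maps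
   D(u, r) to (u|r) t^r, which is the term multiplied by b in the action of
   W_n on A_b (see twist_act_D). *)
Definition witt_div d : A := \sum_i lpartial i (witt_coef d i).

Definition dot u r : K := \sum_i u i * (r i)%:~R.

Lemma lvarVK i : lvarV i * lvar i = 1. Proof. by rewrite -lmonomD addNr. Qed.

Lemma lvar_partial i j : lpartial i (lvar j) = (i == j)%:R *: lvar j.
Proof. by rewrite lpartial_monom ffunE rmorph_nat. Qed.

Lemma sum_lpartial_lvar u i : \sum_j u j *: lpartial j (lvar i) = u i *: lvar i.
Proof.
transitivity (\sum_j u j *: ((j == i)%:R *: lvar i)).
  by apply: eq_bigr => j _; rewrite lvar_partial.
rewrite (bigD1 i) //= eqxx scale1r big1 ?addr0 // => j /negPf ->.
by rewrite scale0r scaler0.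
Qed.

Lemma witt_coef_D u r i : witt_coef (witt_D u r) i = u i *: lmonom K r.
Proof.
transitivity (lvarV i * (lmonom K r * (u i *: lvar i))).
  by rewrite -sum_lpartial_lvar -lend_DE.
by rewrite mulrCA -scalerAr lvarVK -scalerAr mulr1.
Qed.

Lemma witt_div_D u r : witt_div (witt_D u r) = dot u r *: lmonom K r.
Proof.
rewrite scaler_suml; apply: eq_bigr => i _.
by rewrite witt_coef_D lpartialZ lpartial_monom scalerA.
Qed.

Lemma witt_coef_linear i : linear (witt_coef^~ i).
Proof.
move=> c d e; have -> : witt_coef (c *: d + e) i =
    lvarV i * (c *: d (lvar i) + e (lvar i)) by [].
by rewrite mulrDr -scalerAr.
Qed.

Lemma witt_div_linear : linear witt_div.
Proof.
move=> c d e; rewrite scaler_sumr -big_split; apply: eq_bigr => i _.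
by rewrite witt_coef_linear linearP.
Qed.

Lemma witt_E d f : d f = \sum_i witt_coef d i * lpartial i f.
Proof. by rewrite -[LHS]/((d : lend A) f) -witt_diffopE diffop_sum lend_sum. Qed.

(* W_n is spanned by the D(u, r), so that an action of W_n is determined by the
   action of these elements. *)
Lemma witt_span d : d = \sum_i \sum_(r <- msupp (witt_coef d i))
  witt_D [ffun j => (witt_coef d i)@_r * (j == i)%:R] r.
Proof.
have derE (I : Type) (s : seq I) (F : I -> witt) :
    (\sum_(i <- s) F i : witt) = \sum_(i <- s) (F i : lend A) :> lend A.
  by elim/big_rec2: _ => // i y1 y2 _ <-.
apply: derP; rewrite derE; apply: lendP => f; rewrite witt_E lend_sum.
apply: eq_bigr => i _; rewrite derE lend_sum.
rewrite {1}[witt_coef d i]monalgE mulr_suml; apply: eq_bigr => r _.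
rewrite witt_DE lend_DE (_ : \sum_j _ = (witt_coef d i)@_r *: lpartial i f).
  rewrite -scalerAr scalerAl; congr (_ * _); apply/malgP => s.
  by rewrite mcoeffZ mcoeff_lmonom mcoeffU mulr_natr.
rewrite (bigD1 i) //= ffunE eqxx mulr1 big1 ?addr0 // => j /negPf neq_ji.
by rewrite ffunE neq_ji mulr0 scale0r.
Qed.

Lemma lpartialC i j f : lpartial i (lpartial j f) = lpartial j (lpartial i f).
Proof. by apply/malgP => r; rewrite !lpartialE mulrCA. Qed.

Lemma witt_coef_lie d e i :
  witt_coef (lie d e) i = d (witt_coef e i) - e (witt_coef d i).
Proof.
have dvar (d' : witt) : d' (lvar i) = witt_coef d' i * lvar i.
  by rewrite /witt_coef mulrAC lvarVK mul1r.
rewrite {1}/witt_coef -[lie d e]/(der_lie d e) der_lieE lendD lendN !lendM.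
move: (dvar e) (dvar d); move: (witt_coef d i) (witt_coef e i) => F G dvE dvD.
rewrite dvE dvD !derM dvE dvD.
transitivity ((lvarV i * lvar i) * (d G - e F)); first by ring.
by rewrite lvarVK mul1r.
Qed.

Lemma witt_div_lie d e :
  witt_div (lie d e) = d (witt_div e) - e (witt_div d).
Proof.
have step (x y : witt) : \sum_i lpartial i (x (witt_coef y i)) =
    x (witt_div y) +
    \sum_i \sum_j lpartial i (witt_coef x j) * lpartial j (witt_coef y i).
  have -> : x (witt_div y) = \sum_i x (lpartial i (witt_coef y i)).
    exact: linear_sum.
  rewrite -big_split; apply: eq_bigr => i _; cbv beta.
  rewrite !witt_E lpartial_sum -big_split; apply: eq_bigr => j _; cbv beta.
  by rewrite lpartialM [RHS]addrC lpartialC.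
transitivity (\sum_i (lpartial i (d (witt_coef e i)) -
                      lpartial i (e (witt_coef d i)))).
  by apply: eq_bigr => i _; rewrite witt_coef_lie lpartialB.
rewrite sumrB !step opprD addrACA [X in _ + X](_ : _ = 0) ?addr0 //.
apply/eqP; rewrite subr_eq0 exchange_big; apply/eqP.
by apply: eq_bigr => i _; apply: eq_bigr => j _; rewrite mulrC.
Qed.

(* The element of K_n by which d acts on A_b. *)
Definition twist_op (b : K) d : diffop :=
  witt_diffop d + b *: dmul (witt_div d).

Lemma witt_diffop_linear : linear witt_diffop.
Proof.
move=> c d e; apply: diffopP.
by rewrite diffopDE diffopZE !witt_diffopE.
Qed.

Lemma dmul_linear : linear dmul.
Proof.
move=> c f g; apply: diffopP; apply: lendP => h.
by rewrite diffopDE diffopZE lendD lendZ !mulendE mulrDl scalerAl.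
Qed.

Lemma twist_op_linear b : linear (twist_op b).
Proof.
move=> c d e; rewrite /twist_op witt_diffop_linear witt_div_linear dmul_linear.
by rewrite !scalerDr !scalerA [c * b]mulrC addrACA.
Qed.

Lemma twist_op_lie b d e :
  twist_op b (lie d e) =
  twist_op b d * twist_op b e - twist_op b e * twist_op b d.
Proof.
apply: diffopP; apply: lendP => f.
rewrite !(diffopDE, diffopNE, diffopME, diffopZE) !witt_diffopE.
rewrite -![dmul _ : lend A]/(mulend _) witt_div_lie !(lendD, lendN, lendM, lendZ).
rewrite !mulendE !linearD /= !linearZ /= !derM.
have bE (g : A) : b *: g = b%:A * g by rewrite mulr_algl.
move: (b%:A : A) bE => B bE; rewrite !bE; ring.
Qed.

End LaurentOperators.

(* The module A_b: the space A, on which scalars act through their image in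
   K_n. *)
Definition twist (K : fieldType) (n : nat) (b : K)
  (A : lmodType (diffop K n)) : Type := A.

Section Twist.
Variables (K : fieldType) (n : nat) (b : K) (A : lmodType (diffop K n)).

HB.instance Definition _ := GRing.Zmodule.copy (twist b A) A.

Implicit Types (c : K) (v : A) (d e : witt K n).

Definition twist_scale c (v : twist b A) : twist b A :=
  (c%:A : diffop K n) *: (v : A).

Let scaleA c1 c2 v :
  twist_scale c1 (twist_scale c2 v) = twist_scale (c1 * c2) v.
Proof. by rewrite /twist_scale scalerA -scalerAl mul1r scalerA. Qed.
Let scale1 : left_id 1 twist_scale.
Proof. by move=> v; rewrite /twist_scale !scale1r. Qed.
Let scaleDr : right_distributive twist_scale +%R.
Proof. by move=> c v w; apply: scalerDr. Qed.
Let scaleDl v : {morph twist_scale^~ v : c1 c2 / c1 + c2}.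
Proof. by move=> c1 c2; rewrite /twist_scale scalerDl; apply: scalerDl. Qed.

HB.instance Definition _ := GRing.Zmodule_isLmodule.Build K (twist b A)
  scaleA scale1 scaleDr scaleDl.

Definition twist_act d (v : twist b A) : twist b A := twist_op b d *: (v : A).

Let act_linearl v : linear (twist_act^~ v).
Proof.
move=> c d e; rewrite /twist_act twist_op_linear scalerDl; congr (_ + _).
by rewrite -[c *: (_ : twist b A)]/(twist_scale _ _) /twist_scale scalerA mulr_algl.
Qed.
Let act_linearr d : linear (twist_act d).
Proof.
move=> c v w; rewrite /twist_act scalerDr; congr (_ + _).
rewrite -![c *: (_ : twist b A)]/(twist_scale _ _) /twist_scale.
by rewrite !scalerA mulr_algl mulr_algr.
Qed.
Let act_lie d e v :
  twist_act (lie d e) v =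
  twist_act d (twist_act e v) - twist_act e (twist_act d v).
Proof. by rewrite /twist_act !scalerA twist_op_lie scalerBl. Qed.

HB.instance Definition _ := Lmodule_isLieModule.Build K (witt K n) (twist b A)
  act_linearl act_linearr act_lie.

Lemma twist_act_D (u : {ffun 'I_n -> K}) (r : {ffun 'I_n -> int}) v :
  lie_act (witt_D u r) (v : twist b A) =
  diffop_D u r *: v +
  ((b * dot u r) *: (dmul (lmonom K r) *: v : twist b A) : twist b A).
Proof.
have opE : twist_op b (witt_D u r) =
    diffop_D u r + (b * dot u r) *: dmul (lmonom K r).
  apply: diffopP; apply: lendP => f.
  rewrite /twist_op !diffopDE !diffopZE witt_diffopE diffop_DE !lendD !lendZ.
  by congr (_ + _); rewrite !mulendE witt_div_D -scalerAl scalerA.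
rewrite -[LHS]/(twist_op b _ *: v) opE scalerDl.
by congr (_ + _); rewrite -[RHS]/(twist_scale _ _) /twist_scale scalerA mulr_algl.
Qed.

End Twist.

(* The natural module: the Laurent algebra, on which differential operators
   act by evaluation. *)
Definition natural_module (K : fieldType) (n : nat) : Type := laurent K n.

Section NaturalModule.
Variables (K : fieldType) (n : nat).

HB.instance Definition _ := GRing.Zmodule.copy (natural_module K n)
  (laurent K n).

Definition natural_scale (x : diffop K n) (f : natural_module K n) :
  natural_module K n := x (f : laurent K n).

Let scaleA x y f :
  natural_scale x (natural_scale y f) = natural_scale (x * y) f.
Proof. by []. Qed.
Let scale1 : left_id 1 natural_scale. Proof. by []. Qed.
Let scaleDr : right_distributive natural_scale +%R.
Proof. by move=> x f g; apply: (linearD (x : lend (laurent K n))). Qed.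
Let scaleDl f : {morph natural_scale^~ f : x y / x + y}.
Proof. by []. Qed.

HB.instance Definition _ := GRing.Zmodule_isLmodule.Build (diffop K n)
  (natural_module K n) scaleA scale1 scaleDr scaleDl.

End NaturalModule.

(* The subspace h(A), for h the span of the partial_i. *)
Definition cartan_image (K : fieldType) (n : nat) (A : lmodType (diffop K n)) :
  set A := [set v | exists w : 'I_n -> A, v = \sum_i dpartial K i *: w i].
Arguments cartan_image {K n} A _.

(* Main.v *)
Require Import Defs.
From HB Require Import structures.
From mathcomp Require Import all_boot all_algebra.
From mathcomp Require Import boolp classical_sets reals complex.
From mathcomp Require Import finmap ring.
From mathcomp.multinomials Require Import monalg.

Set Implicit Arguments.
Unset Strict Implicit.
Unset Printing Implicit Defensive.

Import GRing.Theory Num.Theory.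
Local Open Scope ring_scope.

(** A nonzero subspace U of A stable under the action of W_n on A_b is compared
    with submodules of A over the algebra K_n of differential operators, which
    are trivial because A is irreducible.  The vector field t^r partial_i acts
    on A_b by the operator T(r) = t^r (partial_i + b r_i), so that U is always
    stable under the partial_i; what may fail is stability under the t^r.

    If b is neither 0 nor 1, the composites T(s - r) T(r) are quadratic in r,
    and their second difference is the operator 2 b (1 - b) r_i^2 t^s
    ([twist_op_second_difference]).  A suitable r makes the coefficient nonzero,
    so U is stable under t^s, hence under K_n, and U = A.

    If b = 1, then T(r) = partial_i t^r, and W_n maps A into h(A).  Hence h(A)
    is a W_n-submodule; it is nonzero, as partial_i t_i - t_i partial_i = t_i,
    so irreducibility of A_1 forces h(A) = A.  Conversely, the vectors x such
    that partial_i t^r x lies in U for all i and r form a K_n-submodule of A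
    that contains U, so it is A, whence h(A) is contained in U.

    If b = 0, then T(r) = t^r partial_i.  The vectors x such that t^r x lies in
    U for all r form a K_n-submodule that is contained in U and contains every
    partial_i u with u in U.  Hence U = A, unless all the partial_i vanish on U.
    In the latter case a nonzero v in U gives a morphism f |-> f v from the
    Laurent polynomials to A, and Schur's lemma makes it an isomorphism
    ([isomorphic_natural_module]).  Conversely, in the natural module the line
    of constants is a proper W_n-submodule. *)

(** * Irreducible modules *)

Lemma submod_closed_setP (S : nzRingType) (M : lmodType S) (U : set M) :
  submod_closed (mem U) <->
  U 0 /\ forall a u v, U u -> U v -> U (a *: u + v).
Proof.
split=> -[U0 UL]; split.
- by have := U0; rewrite in_setE.
- by move=> a u v Uu Uv; have := UL a u v; rewrite !in_setE; apply.
- by rewrite in_setE.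
by move=> a u v; rewrite !in_setE; apply: UL.
Qed.

Lemma irreducible_moduleT (S : nzRingType) (M : lmodType S) (U : set M) (v : M) :
  irreducible_module M -> submod_closed (mem U) -> U v -> v != 0 ->
  forall w, U w.
Proof.
move=> [_ irrM] /irrM[] -> // -> /eqP //.
Qed.

Lemma schur_bijective (S : nzRingType) (M N : lmodType S)
    (f : {linear M -> N}) (x : M) :
  irreducible_module M -> irreducible_module N -> f x != 0 -> bijective f.
Proof.
move=> irrM irrN fx0.
have injf y : f y = 0 -> y = 0.
  move=> fy0; apply: contrapT => /eqP y0; move/eqP: fx0; apply.
  apply: (@irreducible_moduleT _ _ [set z | f z = 0]%classic y) => //.
  apply/submod_closed_setP; split=> [|a u v /= fu0 fv0]; first exact: raddf0.
  by rewrite linearP fu0 fv0 scaler0 addr0.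
have surf w : exists z, f z = w.
  apply: (@irreducible_moduleT _ _ [set w' | exists z, f z = w']%classic (f x));
    [exact: irrN | | by exists x | exact: fx0].
  apply/submod_closed_setP; split=> [|a _ _ [u <-] [v <-]].
    by exists 0; exact: raddf0.
  by exists (a *: u + v); rewrite linearP.
pose g w := projT1 (cid (surf w)).
have gK : cancel g f by move=> w; exact: (projT2 (cid (surf w))).
exists g => // y; apply/eqP; rewrite -subr_eq0; apply/eqP/injf.
by rewrite linearB /= gK subrr.
Qed.

Lemma bijective_isomorphic_inv (S : nzRingType) (M N : lmodType S)
    (f : {linear M -> N}) : bijective f -> isomorphic_modules N M.
Proof.
move=> [g fK gK].
have ling : linear g.
  by move=> a x y; apply: (can_inj fK); rewrite linearP /= !gK.
pose gL := GRing.isLinear.Build _ _ _ _ g ling.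
pose gl : {linear N -> M} := HB.pack g gL.
by exists gl; exists f.
Qed.

(** * Differential operators on Laurent polynomials *)

Section DifferentialOperators.
Variables (K : fieldType) (n : nat).
Implicit Types (x y : diffop K n) (f g : laurent K n).
Implicit Types (r s : {ffun 'I_n -> int}) (i : 'I_n).

(** The elements satisfying P form a subalgebra containing the generators, and
    K_n is the smallest such subalgebra. *)
Lemma diffop_ind (P : diffop K n -> Prop) :
  P 1 -> (forall c x y, P x -> P y -> P (c *: x + y)) ->
  (forall x y, P x -> P y -> P (x * y)) ->
  (forall r, P (dmul (lmonom K r))) -> (forall i, P (dpartial K i)) ->
  forall x, P x.
Proof.
move=> P1 PL PM Pt Pd x.
pose S : {pred lend (laurent K n)} :=
  fun a => `[< exists2 y : diffop K n, a = y & P y >].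
have : (x : lend _) \in S.
  have /asboolP := diffop_subproof x; apply.
  - split=> [|c a a' /asboolP[y -> Py] /asboolP[z -> Pz]
             |a a' /asboolP[y -> Py] /asboolP[z -> Pz]]; apply/asboolP.
    + by exists 1.
    + by exists (c *: y + z) => //; apply: PL.
    + by exists (y * z) => //; apply: PM.
  - by move=> i; apply/asboolP; exists (dmul (lvar K i)); last exact: Pt.
  - by move=> i; apply/asboolP; exists (dmul (lvarV K i)); last exact: Pt.
  - by move=> i; apply/asboolP; exists (dpartial K i).
by move=> /asboolP[y /diffopP ->].
Qed.

Lemma diffop_ext x y :
  (forall s, x (lmonom K s) = y (lmonom K s)) -> x = y.
Proof.
move=> eqxy; apply/diffopP/lendP/laurent_linear_ext => //.
- exact: lend_linear.
- exact: lend_linear.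
Qed.

Lemma dmulM f g : dmul (f * g) = dmul f * dmul g.
Proof. by apply/diffopP/lendP => h; rewrite lendM !mulendE mulrA. Qed.

Lemma dmul1 : dmul (1 : laurent K n) = 1.
Proof. by apply/diffopP/lendP => h; rewrite mulendE mul1r. Qed.

Lemma dpartial_dmul i f :
  dpartial K i * dmul f = dmul f * dpartial K i + dmul (lpartial K i f).
Proof.
by apply/diffopP/lendP => h; rewrite lendD !lendM !mulendE lpartialM addrC.
Qed.

Lemma dmulZ c f : dmul (c *: f) = c *: dmul f.
Proof. by apply/diffopP/lendP => h; rewrite lendZ !mulendE scalerAl. Qed.

(** The K-subspaces of A, which are also those of each A_b: scalars act through
    their image in K_n. *)
Definition scalar_subspace (A : lmodType (diffop K n)) (U : set A) : Prop :=
  U 0 /\ forall c u v, U u -> U v -> U ((c%:A : diffop K n) *: u + v).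

Lemma scalar_subspaceZ (A : lmodType (diffop K n)) (U : set A) c u :
  scalar_subspace U -> U u -> U ((c%:A : diffop K n) *: u).
Proof. by move=> [U0 UL] Uu; have := UL c u 0 Uu U0; rewrite addr0. Qed.

Lemma scalar_subspaceD (A : lmodType (diffop K n)) (U : set A) u v :
  scalar_subspace U -> U u -> U v -> U (u + v).
Proof. by move=> [_ UL] Uu Uv; have := UL 1 u v Uu Uv; rewrite !scale1r. Qed.

Lemma submod_closed_generators (A : lmodType (diffop K n)) (B : set A) :
  scalar_subspace B ->
  (forall r u, B u -> B (dmul (lmonom K r) *: u)) ->
  (forall i u, B u -> B (dpartial K i *: u)) -> submod_closed (mem B).
Proof.
move=> subB Bt Bd; apply/submod_closed_setP; split=> [|x u v Bu Bv].
  by case: subB.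
suff Bx : forall w, B w -> B (x *: w).
  exact: (scalar_subspaceD subB (Bx u Bu) Bv).
elim/diffop_ind: x {u v Bu Bv} => [w|c x y Px Py w Bw|x y Px Py w Bw|r|i].
- by rewrite scale1r.
- rewrite scalerDl -mulr_algl -scalerA.
  apply: (scalar_subspaceD subB _ (Py w Bw)).
  exact: (scalar_subspaceZ _ subB (Px w Bw)).
- by rewrite -scalerA; apply/Px/Py.
- exact: Bt.
- exact: Bd.
Qed.

(** * The operators by which vector fields act on A_b *)

Definition coord_field i r : witt K n := witt_D [ffun j => (j == i)%:R] r.

Lemma twist_op_coord b i r :
  twist_op b (coord_field i r) =
  dmul (lmonom K r) * dpartial K i + (b * (r i)%:~R) *: dmul (lmonom K r).
Proof.
have sumi (V : lmodType K) (F : 'I_n -> V) :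
    \sum_j ([ffun j => (j == i)%:R] : {ffun 'I_n -> K}) j *: F j = F i.
  rewrite (bigD1 i) //= ffunE eqxx scale1r big1 ?addr0 // => j /negPf ji.
  by rewrite ffunE ji scale0r.
apply: diffopP; apply: lendP => f.
rewrite !diffopDE !diffopZE witt_diffopE !lendD !lendZ lendM !mulendE.
rewrite [X in X + _]lend_DE witt_div_D sumi -scalerAl scalerA.
suff -> : dot [ffun j => (j == i)%:R] r = (r i)%:~R :> K by [].
exact: (sumi K^o).
Qed.

Lemma twist_op_coord_monom b i r s :
  twist_op b (coord_field i r) (lmonom K s) =
  ((s i)%:~R + b * (r i)%:~R) *: lmonom K (r + s).
Proof.
rewrite twist_op_coord lendD lendZ lendM !mulendE lpartial_monom.
by rewrite -scalerAr -scalerDl lmonomD.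
Qed.

Lemma twist_op_coord0 b i : twist_op b (coord_field i 0) = dpartial K i.
Proof.
rewrite twist_op_coord lmonom0 dmul1 mul1r [X in X%:~R]ffunE mulr0.
by rewrite scale0r addr0.
Qed.

(** On t^q, the operator T t is (q_i + b t_i) ((1 - b) t_i + q_i + b s_i), up to
    the shift to t^(s + q); it is quadratic in t_i with leading coefficient
    b (1 - b), which the second difference isolates. *)
Lemma twist_op_second_difference b i r s :
  let T t := twist_op b (coord_field i (s - t)) * twist_op b (coord_field i t)
  in T r + T (- r) - 2 *: T 0 =
     (2 * b * (1 - b) * (r i)%:~R ^+ 2) *: dmul (lmonom K s).
Proof.
move=> T; apply: diffop_ext => q.
have TE t : T t (lmonom K q) =
    (((q i)%:~R + b * (t i)%:~R) *
     ((t i)%:~R + (q i)%:~R + b * ((s i)%:~R - (t i)%:~R))) *: lmonom K (s + q).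
  have appZ (x : diffop K n) c f : x (c *: f) = c *: x f by exact: linearZ.
  rewrite lendM twist_op_coord_monom appZ twist_op_coord_monom.
  by rewrite addrA subrK scalerA !ffunE rmorphD rmorphB.
have diffE (x y z : diffop K n) c f :
    (x + y - c *: z) f = x f + y f - c *: z f by [].
rewrite diffE !TE [RHS]lendZ mulendE -lmonomD !ffunE rmorphN.
rewrite !scalerA -scalerDl -scalerBl; congr (_ *: _).
by rewrite mulr0z; ring.
Qed.

End DifferentialOperators.

Lemma twist_op0 (K : fieldType) n (d : witt K n) :
  twist_op 0 d = \sum_i dmul (witt_coef d i) * dpartial K i.
Proof. by rewrite /twist_op scale0r addr0. Qed.

(** The divergence term of the action at b = 1 moves the partial_i to the left
    of the coefficients, by the Leibniz rule. *)
Lemma twist_op1 (K : fieldType) n (d : witt K n) :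
  twist_op 1 d = \sum_i dpartial K i * dmul (witt_coef d i).
Proof.
apply/diffopP/lendP => f; rewrite diffopDE diffopZE lendD lendZ scale1r.
rewrite !diffop_sum !lend_sum mulendE mulr_suml -big_split.
by apply: eq_bigr => i _; rewrite [LHS]addrC [RHS]lpartialM.
Qed.

(** * Irreducibility of the natural module *)

(** The operator partial_i - r_i keeps the support of f from growing and deletes
    from it the exponents whose i-th entry is r_i; this reduces any nonzero f in
    a submodule to a monomial, and monomials are invertible. *)
Lemma natural_module_irreducible (K : numFieldType) n :
  irreducible_module (natural_module K n).
Proof.
split=> [|U /submod_closed_setP[U0 UL]].
  by exists (1 : laurent K n); exact: (oner_neq0 (laurent K n)).
have UZ (x : diffop K n) (f : laurent K n) : U f -> U (x f).
  by move=> Uf; have := UL x f 0 Uf U0; rewrite addr0.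
have supp0 (f : laurent K n) : f != 0 -> exists r, r \in msupp f.
  move=> f0; apply: contrapT => /forallNP nf; case/eqP: f0.
  apply/malgP => r; transitivity (0 : K); last exact/esym/mcoeff0.
  by apply/mcoeff_outdom/negP/nf.
have U1 : forall m (f : laurent K n), (#|` msupp f| <= m)%N -> U f -> f != 0 ->
    U (1 : laurent K n).
  elim=> [|m IH] f lefm Uf /supp0[r rf].
    by move: lefm rf; rewrite leqn0 cardfs_eq0 => /eqP ->; rewrite in_fset0.
  have [[s sf /eqP sr]|uniqr] :=
    pselect (exists2 s, s \in msupp f & s <> r).
    have [i sri] : exists i, s i != r i.
      apply: contrapT => /forallNP nsr; case/eqP: sr; apply/ffunP => i.
      by apply/eqP; apply: contrapT => sri; apply: (nsr i); apply/negP.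
    (* This operator deletes r from the support and keeps s. *)
    pose g := (dpartial K i - (r i)%:~R *: 1) f : laurent K n.
    have gE t : g@_t = ((t i)%:~R - (r i)%:~R) * f@_t.
      by rewrite /g lendD lendN lendZ lend1 mcoeffB mcoeffZ lpartialE mulrBl.
    apply: (IH g).
    - rewrite -ltnS; apply: leq_trans lefm.
      apply: fproper_ltn_card; apply/andP; split; last first.
        apply/negP => /fsubsetP/(_ r rf); rewrite -mcoeff_neq0 gE subrr.
        by rewrite mul0r eqxx.
      apply/fsubsetP => t.
      by rewrite -!mcoeff_neq0 gE mulf_eq0 negb_or => /andP[].
    - exact: UZ.
    - apply/eqP => g0; move: sf; rewrite -mcoeff_neq0 => /eqP; apply.
      have /eqP := gE s; rewrite g0 mcoeff0 eq_sym mulf_eq0 subr_eq0.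
      by rewrite eqr_int (negPf sri) => /eqP.
  have fE : f = f@_r *: lmonom K r.
    apply/malgP => s; rewrite mcoeffZ mcoeff_lmonom.
    have [<-|rs] := eqVneq r s; first by rewrite mulr1.
    rewrite mulr0; apply/eqP; rewrite mcoeff_eq0; apply/negP => sf.
    by apply: uniqr; exists s => //; apply/eqP; rewrite eq_sym.
  have fr0 : f@_r != 0 by rewrite mcoeff_neq0.
  have := UZ ((f@_r)^-1 *: dmul (lmonom K (- r))) f Uf.
  rewrite lendZ mulendE {2}fE -scalerAr scalerA mulVf // scale1r.
  by rewrite -lmonomD addNr lmonom0.
have [[f Uf /eqP f0]|allU0] := pselect (exists2 f, U f & f <> 0).
  right; apply/seteqP; split=> // g _.
  have := UZ (dmul (g : laurent K n)) _ (U1 _ f (leqnn _) Uf f0).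
  by rewrite mulendE mulr1.
left; apply/seteqP; split=> [f Uf|_ -> //].
by apply: contrapT => f0; apply: allU0; exists f.
Qed.

(** * Irreducibility of A_b *)

Section Modules.
Variables (K : numFieldType) (n : nat) (A : lmodType (diffop K n)).
Hypothesis irrA : irreducible_module A.

(** On a vector killed by the partial_i, an operator x satisfies
    x (f v) = x(f) v: so f |-> f v is a morphism of irreducible modules, and it
    does not vanish at 1. *)
Lemma isomorphic_natural_module (v : A) : v != 0 ->
  (forall i, dpartial K i *: v = 0) ->
  isomorphic_modules A (natural_module K n).
Proof.
move=> v0 dv0.
pose phi (f : natural_module K n) : A := dmul (f : laurent K n) *: v.
have phiZ (x : diffop K n) f : phi (x *: f) = x *: phi f.
  rewrite /phi; elim/diffop_ind: x f => [f|c x y Px Py f|x y Px Py f|r f|i f].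
  - by rewrite !scale1r.
  - rewrite [RHS]scalerDl -Py -[in RHS]mulr_algl -[in RHS]scalerA -Px.
    by rewrite [in RHS]scalerA -scalerDl mulr_algl -dmul_linear.
  - by rewrite -[RHS]scalerA -Py -Px -[(x * y) *: f]scalerA.
  - by rewrite [RHS]scalerA -dmulM.
  - by rewrite [RHS]scalerA dpartial_dmul scalerDl -scalerA dv0 scaler0 add0r.
have linphi : linear phi.
  move=> x f g; rewrite -phiZ /phi -scalerDl; congr (_ *: v).
  by rewrite -[X in _ = X + _]scale1r -dmul_linear scale1r.
pose phiL := GRing.isLinear.Build _ _ _ _ phi linphi.
pose phil : {linear natural_module K n -> A} := HB.pack phi phiL.
apply: (@bijective_isomorphic_inv _ _ _ phil).
apply: (@schur_bijective _ _ _ phil (1 : laurent K n)) => //.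
  exact: natural_module_irreducible.
by rewrite /= /phi dmul1 scale1r.
Qed.

(** Restates irreducibility of A_b inside A, so that U can be compared with
    K_n-submodules. *)
Lemma irreducible_twist b :
  (forall U : set A, scalar_subspace U ->
     (forall d u, U u -> U (twist_op b d *: u)) ->
     forall v, U v -> v != 0 -> U = setT) ->
  irreducible_lie_module (twist b A).
Proof.
move=> full; split=> [|U /submod_closed_setP[U0 UL] Uact].
  by have [[v v0] _] := irrA; exists v.
have [[v Uv /eqP v0]|allU0] := pselect (exists2 v, U v & v <> 0).
  by right; apply: (full U (conj U0 UL) Uact v).
left; apply/seteqP; split=> [v Uv|_ -> //].
by apply: contrapT => v0; apply: allU0; exists v.
Qed.

Lemma irreducible_twist_generic b : (0 < n)%N -> b <> 0 -> b <> 1 ->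
  irreducible_lie_module (twist b A).
Proof.
move=> n_gt0 b0 b1; apply: irreducible_twist => U subU Uact v Uv v0.
apply/seteqP; split=> // w _.
apply: (@irreducible_moduleT _ _ U v irrA _ Uv v0).
apply: (submod_closed_generators subU) => [s u Uu|i u Uu]; last first.
  by rewrite -(twist_op_coord0 b); apply: Uact.
(* With r_i = 1, the coefficient of t^s in the second difference is
   2 b (1 - b). *)
pose i : 'I_n := Ordinal n_gt0; pose r := zbasis i.
have c0 : 2 * b * (1 - b) * (r i)%:~R ^+ 2 != 0 :> K.
  rewrite !mulf_neq0 ?pnatr_eq0 ?subr_eq0 ?ffunE ?eqxx ?oner_neq0 //.
    exact/eqP.
  by rewrite eq_sym; apply/eqP.
set c := 2 * b * (1 - b) * _ in c0.
have -> : dmul (lmonom K s) *: u =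
    (c^-1%:A : diffop K n) *: ((c *: dmul (lmonom K s)) *: u).
  by rewrite scalerA mulr_algl scalerA mulVf // scale1r.
rewrite -twist_op_second_difference; apply: (scalar_subspaceZ _ subU).
pose T t := twist_op b (coord_field K i (s - t)) * twist_op b (coord_field K i t).
have UT t : U (T t *: u) by rewrite -scalerA; apply/Uact/Uact.
have -> : (T r + T (- r) - 2 *: T 0) *: u =
    ((-2)%:A : diffop K n) *: (T 0 *: u) + (T r *: u + T (- r) *: u).
  by rewrite [_%:A *: (_ *: _)]scalerA mulr_algl addrC -!scalerDl scaleNr.
apply: (subU.2) => //; exact: (scalar_subspaceD subU).
Qed.

Lemma irreducible_twist1 : cartan_image A = setT ->
  irreducible_lie_module (twist 1 A).
Proof.
move=> hA; apply: irreducible_twist => U subU Uact v Uv v0.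
have act1E i r : twist_op 1 (coord_field K i r) =
    dpartial K i * dmul (lmonom K r).
  by rewrite twist_op_coord dpartial_dmul lpartial_monom mul1r dmulZ.
(* B contains U because U is stable under the partial_i t^r.  It is stable under
   partial_j since t^r partial_j = (partial_j - r_j) t^r, and B being everything
   puts h(A) inside U. *)
pose B :=
  [set x | forall i r, U (dpartial K i *: (dmul (lmonom K r) *: x))]%classic.
have BT : forall x, B x.
  apply: (@irreducible_moduleT _ _ B v irrA) => //; last first.
    by move=> i r; rewrite scalerA -act1E; apply: Uact.
  apply: submod_closed_generators.
  - split=> [i r|]; first by rewrite !scaler0; case: subU.
    move=> c x y Bx By i r; rewrite !scalerDr.
    apply: (scalar_subspaceD subU) => //.
    rewrite !scalerA -mulrA mulr_algr -scalerAr -mulr_algl -!scalerA.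
    exact/(scalar_subspaceZ _ subU)/Bx.
  - by move=> s x Bx i r; rewrite [dmul _ *: (_ *: _)]scalerA -dmulM -lmonomD.
  - move=> j x Bx i r; rewrite [dmul _ *: (_ *: _)]scalerA.
    have -> : dmul (lmonom K r) * dpartial K j =
        - (r j)%:~R *: dmul (lmonom K r) + dpartial K j * dmul (lmonom K r).
      by rewrite dpartial_dmul lpartial_monom dmulZ scaleNr addrCA addNr addr0.
    rewrite scalerDl scalerDr; apply: (scalar_subspaceD subU).
      by rewrite scalerA -scalerAr -mulr_algl -!scalerA;
        exact/(scalar_subspaceZ _ subU)/Bx.
    by rewrite -scalerA -(twist_op_coord0 1 i); apply/Uact/Bx.
apply/seteqP; split=> // w _.
have : cartan_image A w by rewrite hA.
move=> [y ->]; elim/big_ind: _ => [|x z Ux Uz|i _].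
- by case: subU.
- exact: (scalar_subspaceD subU).
by have := BT (y i) i 0; rewrite lmonom0 dmul1 scale1r.
Qed.

Lemma irreducible_twist0 : ~ isomorphic_modules A (natural_module K n) ->
  irreducible_lie_module (twist 0 A).
Proof.
move=> niso; apply: irreducible_twist => U subU Uact v Uv v0.
have act0E i r : twist_op 0 (coord_field K i r) =
    dmul (lmonom K r) * dpartial K i.
  by rewrite twist_op_coord mul0r scale0r addr0.
have [i dv0] : exists i, dpartial K i *: v != 0.
  apply: contrapT => /forallNP dv0.
  apply/niso/(isomorphic_natural_module v0) => i.
  by apply/eqP; apply: contrapT => /negP; apply: dv0.
(* The largest subset of U stable under the Laurent monomials. *)
pose B := [set x | forall r, U (dmul (lmonom K r) *: x)]%classic.
have BU x : B x -> U x by move/(_ 0); rewrite lmonom0 dmul1 scale1r.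
have Bd j x : U x -> B (dpartial K j *: x).
  by move=> Ux r; rewrite scalerA -act0E; apply: Uact.
apply/seteqP; split=> // w _; apply/BU; move: w.
apply: (@irreducible_moduleT _ _ B (dpartial K i *: v) irrA) => //;
  last exact: Bd.
apply: submod_closed_generators.
- split=> [r|c x y Bx By r]; first by rewrite scaler0; case: subU.
  rewrite scalerDr scalerA mulr_algr -mulr_algl -scalerA.
  exact: (subU.2).
- by move=> s x Bx r; rewrite scalerA -dmulM -lmonomD.
- by move=> j x /BU; apply: Bd.
Qed.

(** At b = 1 every operator of W_n has its image in h(A), by [twist_op1], so
    h(A) is a submodule of A_1. *)
Lemma twist1_cartan_image : (0 < n)%N -> irreducible_lie_module (twist 1 A) ->
  cartan_image A = setT.
Proof.
move=> n_gt0 [_ irr1]; pose i : 'I_n := Ordinal n_gt0.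
have hAd j x : cartan_image A (dpartial K j *: x).
  exists (fun k => if k == j then x else 0).
  rewrite (bigD1 j) //= eqxx big1 ?addr0 // => k /negPf ->.
  by rewrite scaler0.
have hA0 : cartan_image A 0.
  by exists (fun=> 0); rewrite big1 // => k _; rewrite scaler0.
have hAL (c : K) (x y : twist 1 A) : cartan_image A x -> cartan_image A y ->
    cartan_image A (c *: x + y).
  move=> [p ->] [q ->]; exists (fun k => (c%:A : diffop K n) *: p k + q k).
  rewrite [c *: _]scaler_sumr -big_split; apply: eq_bigr => k _ /=.
  rewrite [RHS]scalerDr; congr (_ + _).
  rewrite -[LHS]/((c%:A : diffop K n) *: (dpartial K k *: p k)).
  by rewrite !scalerA mulr_algl mulr_algr.
have [|||//] := irr1 (cartan_image A).
- exact/submod_closed_setP.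
- move=> d x _; rewrite -[lie_act d x]/(twist_op 1 d *: (x : A)) twist_op1.
  exists (fun k => dmul (witt_coef d k) *: (x : A)).
  by rewrite scaler_suml; apply: eq_bigr => k _; rewrite scalerA.
(* If h(A) = 0, then t_i = partial_i t_i - t_i partial_i also acts as 0, though
   t_i is invertible. *)
move=> h0; have [[v v0] _] := irrA.
have dx0 j (x : A) : dpartial K j *: x = 0 by have := hAd j x; rewrite h0.
case/eqP: v0.
have : dmul (lvar K i) *: v = 0.
  have := dx0 i (dmul (lvar K i) *: v).
  rewrite scalerA dpartial_dmul scalerDl -scalerA dx0 scaler0 add0r.
  by rewrite lvar_partial eqxx scale1r.
move/(congr1 (fun x => dmul (lvarV K i) *: x)).
by rewrite scalerA -dmulM lvarVK dmul1 scale1r scaler0.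
Qed.

(** The preimage v of the constant 1 is killed by the partial_i, hence at b = 0
    by W_n, so its line is a submodule of A_0. *)
Lemma twist0_not_natural : (0 < n)%N -> irreducible_lie_module (twist 0 A) ->
  ~ isomorphic_modules A (natural_module K n).
Proof.
move=> n_gt0 [_ irr0] [f [g fK gK]]; pose i : 'I_n := Ordinal n_gt0.
pose v := g (1 : laurent K n).
have v0 : v <> 0.
  move=> v0; have := gK (1 : laurent K n); rewrite -/v v0 raddf0 => /eqP.
  by rewrite eq_sym (negPf (oner_neq0 (laurent K n))).
have dv0 j : dpartial K j *: v = 0.
  apply: (can_inj fK); rewrite linearZ /= gK raddf0.
  rewrite -[LHS]/(lpartial K j (lmonom K 0)) lpartial_monom [X in X%:~R]ffunE.
  by rewrite scale0r.
pose U := [set x : twist 0 A | exists c : K, x = c *: (v : twist 0 A)]%classic.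
have [||U0|UT] := irr0 U.
- apply/submod_closed_setP; split=> [|a _ _ [c ->] [d ->]].
    by exists 0; rewrite scale0r.
  by exists (a * c + d); rewrite scalerDl scalerA.
- move=> d _ [c ->]; exists 0; rewrite scale0r.
  rewrite -[LHS]/(twist_op 0 d *: ((c%:A : diffop K n) *: v)).
  rewrite scalerA mulr_algr -mulr_algl -scalerA.
  suff -> : twist_op 0 d *: v = 0 by rewrite scaler0.
  rewrite twist_op0 scaler_suml big1 // => j _.
  by rewrite -scalerA dv0 scaler0.
- have Uv : U v by exists 1; rewrite scale1r.
  by move: Uv; rewrite U0 => /v0.
(* t_i v lies outside the line of v: partial_i kills v but fixes t_i v. *)
have : U (dmul (lvar K i) *: v) by rewrite UT.
move=> [c].
rewrite -[c *: (v : twist _ _)]/((c%:A : diffop K n) *: v).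
move=> /(congr1 (fun x => dmul (lvarV K i) *: (dpartial K i *: (x : A)))).
rewrite [dpartial K i *: (c%:A *: _)]scalerA mulr_algr -mulr_algl -scalerA dv0.
rewrite !scaler0 [dpartial K i *: _]scalerA dpartial_dmul scalerDl.
rewrite -scalerA dv0 scaler0 add0r lvar_partial eqxx scale1r.
by rewrite scalerA -dmulM lvarVK dmul1 scale1r.
Qed.

End Modules.

Theorem theorem6 (R : realType) (n : nat) (n_gt0 : (0 < n)%N) (b : R[i])
    (A : lmodType (diffop R[i] n)) (irrA : irreducible_module A) :
  irreducible_lie_module (twist b A) <->
  [\/ b <> 0 /\ b <> 1,
      b = 1 /\ cartan_image A = setT
    | b = 0 /\ ~ isomorphic_modules A (natural_module R[i] n)].
Proof.
split=> [irrb|[[b0 b1]|[-> hA]|[-> niso]]].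
- have [b0|b0] := eqVneq b 0.
    by apply: Or33; split=> //; apply: twist0_not_natural; rewrite -?b0.
  have [b1|b1] := eqVneq b 1.
    by apply: Or32; split=> //; apply: twist1_cartan_image; rewrite -?b1.
  by apply: Or31; split; apply/eqP.
- exact: irreducible_twist_generic.
- exact: irreducible_twist1.
- exact: irreducible_twist0.
Qed.
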